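(* Let $OABC$ be a tangential LEQ and let $\sigma,\tau$ be the associated quantities defined in the context. Then the only possibilities for the unordered pair $\{\sigma,\tau\}$ are $\{9,\frac98\}$, $\{5,\frac54\}$, $\{3,\frac32\}$ and $\{2,2\}$.
   Context: A quadrilateral $OABC$ is given by four points of the plane, no three colinear, such that the segments $OA,AB,BC,CO$ have no interior points of intersection; it may be convex or concave. The vertices are written in positive (counterclockwise) cyclic order and, if $OABC$ is concave, the labelling is chosen so that the reflex angle is at $B$. The lengths of $OA,AB,BC,CO$ are $a,b,c,d$. A lattice equable quadrilateral (LEQ) is a quadrilateral whose vertices lie on $\mathbb Z^2$ and whose area equals its perimeter. A quadrilateral is tangential if it has an incircle, i.e. a circle inside it tangent to its four sides (in the concave case, to the sides or their extensions); equivalently $a+c=b+d$. For a tangential LEQ $OABC$ define $$\sigma=\frac{ad+bc+2\delta\sqrt{abcd-4(a+c)^2}}{16+(a-b)^2},\qquad \tau=\frac{ab+cd-2\delta\sqrt{abcd-4(a+c)^2}}{16+(a-d)^2},$$ where $\delta=1$ if $B$ lies within the circumcircle of the triangle $OAC$, and $\delta=-1$ otherwise. *)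

(* Defs.v *)
From Stdlib Require Import Reals List Classical ClassicalEpsilon.
Import ListNotations.
Open Scope R_scope.

Definition point : Type := (R * R)%type.

Definition distance (P Q : point) : R :=
  dist_euc (fst P) (snd P) (fst Q) (snd Q).

(* Twice the signed area of the triangle PQS; positive iff P, Q, S turn
   counterclockwise. *)
Definition cross (P Q S : point) : R :=
  (fst Q - fst P) * (snd S - snd P) - (snd Q - snd P) * (fst S - fst P).

Definition collinear (P Q S : point) : Prop := cross P Q S = 0.

Definition comb (X Y : point) (t : R) : point :=
  ((1 - t) * fst X + t * fst Y, (1 - t) * snd X + t * snd Y).

Definition on_line (X Y Q : point) : Prop :=
  exists t : R, Q = comb X Y t.

Definition on_segment (X Y Q : point) : Prop :=
  exists t : R, 0 <= t <= 1 /\ Q = comb X Y t.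

Definition interior_of_segment (X Y Q : point) : Prop :=
  exists t : R, 0 < t < 1 /\ Q = comb X Y t.

Definition in_triangle (P Q S X : point) : Prop :=
  exists u v w : R,
    0 <= u /\ 0 <= v /\ 0 <= w /\ u + v + w = 1 /\
    X = (u * fst P + v * fst Q + w * fst S,
         u * snd P + v * snd Q + w * snd S).

Definition lattice_point (P : point) : Prop :=
  exists x y : Z, P = (IZR x, IZR y).

Definition sides (O A B C : point) : list (point * point) :=
  [(O, A); (A, B); (B, C); (C, O)].

Definition perimeter (O A B C : point) : R :=
  distance O A + distance A B + distance B C + distance C O.

(* Shoelace formula, written as a sum over the triangles OAB and OBC. *)
Definition signed_area (O A B C : point) : R :=
  (cross O A B + cross O B C) / 2.

Definition area (O A B C : point) : R := Rabs (signed_area O A B C).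

(* For consecutive vertices U, V, W of a counterclockwise simple polygon:
   the interior angle at V exceeds a straight angle. *)
Definition reflex (U V W : point) : Prop := cross U V W < 0.

Definition concave (O A B C : point) : Prop :=
  reflex C O A \/ reflex O A B \/ reflex A B C \/ reflex B C O.

Record quadrilateral (O A B C : point) : Prop := {
  quad_OAB : ~ collinear O A B;
  quad_OAC : ~ collinear O A C;
  quad_OBC : ~ collinear O B C;
  quad_ABC : ~ collinear A B C;
  quad_simple :
    ForallOrdPairs
      (fun s t => forall Q : point,
         ~ (interior_of_segment (fst s) (snd s) Q /\
            interior_of_segment (fst t) (snd t) Q))
      (sides O A B C);
  quad_positive : 0 < signed_area O A B C;
  quad_label : concave O A B C -> reflex A B C
}.

Record LEQ (O A B C : point) : Prop := {
  leq_quad : quadrilateral O A B C;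
  leq_O : lattice_point O;
  leq_A : lattice_point A;
  leq_B : lattice_point B;
  leq_C : lattice_point C;
  leq_equable : area O A B C = perimeter O A B C
}.

(* The closed region bounded by OABC. Since a reflex angle can only occur at B,
   the diagonal OB lies in the region and cuts it into these two triangles. *)
Definition region (O A B C X : point) : Prop :=
  in_triangle O A B X \/ in_triangle O B C X.

(* The circle of centre P and radius r meets the line XY exactly at T. *)
Definition tangent_at (P : point) (r : R) (X Y T : point) : Prop :=
  on_line X Y T /\
  forall Q : point, on_line X Y Q -> (distance P Q = r <-> Q = T).

(* In the concave case the circle may touch the extension of a side. *)
Definition incircle (O A B C P : point) (r : R) : Prop :=
  0 < r /\
  (forall Q : point, distance P Q <= r -> region O A B C Q) /\
  (forall X Y : point, In (X, Y) (sides O A B C) ->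
     exists T : point,
       tangent_at P r X Y T /\
       (~ concave O A B C -> on_segment X Y T)).

Definition tangential (O A B C : point) : Prop :=
  exists (P : point) (r : R), incircle O A B C P r.

(* When B lies exactly on the circumcircle of OAC, a tangential LEQ has
   abcd = 4(a+c)^2, so delta then plays no role and the strictness of the
   inequality is immaterial. *)
Definition within_circumcircle (O A C B : point) : Prop :=
  exists K : point,
    distance K A = distance K O /\ distance K C = distance K O /\ distance K B < distance K O.

Definition quad_delta (O A B C : point) : R :=
  if excluded_middle_informative (within_circumcircle O A C B)
  then 1 else -1.

Definition quad_sigma (O A B C : point) : R :=
  let a := distance O A in
  let b := distance A B in
  let c := distance B C in
  let d := distance C O in
  (a * d + b * c
     + 2 * quad_delta O A B C * sqrt (a * b * c * d - 4 * (a + c) ^ 2))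
  / (16 + (a - b) ^ 2).

Definition quad_tau (O A B C : point) : R :=
  let a := distance O A in
  let b := distance A B in
  let c := distance B C in
  let d := distance C O in
  (a * b + c * d
     - 2 * quad_delta O A B C * sqrt (a * b * c * d - 4 * (a + c) ^ 2))
  / (16 + (a - d) ^ 2).

(* Equality {s, t} = {x, y} of unordered pairs. *)
Definition same_pair (s t x y : R) : Prop :=
  (s = x /\ t = y) \/ (s = y /\ t = x).

(* Main.v *)
(** Put [u = a - b], [v = a - d], [s = a + c = b + d], and write the squared
    diagonals as [OB^2 = u^2 + 16 y] and [AC^2 = v^2 + 16 z].  Since the area
    is [2 s], Heron's formula on the four triangles cut off by the diagonals
    gives [OAB = s + v y] and [OAC = s + u z] (as areas) together with
    quadratic equations whose roots are the two possible values of [tau] and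
    [sigma]; the in-circle determinant of [O, A, B, C] equals
    [2 s (y (16 + v^2) - (ab + cd))], so its sign picks [tau = y] and
    [sigma = z].  The linear relation between the vectors [OA], [OB], [OC]
    turns into [y z = y + z].  The sides are integers, so [16 y - 16] and
    [16 z - 16] are positive integers with product [256].  The factorization
    [1 * 256] would give [16 s^2 = 17 (272 + 16 v^2 + u^2)] or its mirror
    image, which is impossible modulo powers of 2. *)

Require Import Defs.
From Stdlib Require Import Reals List ZArith Lra Lia Psatz Classical ClassicalEpsilon.
Import ListNotations.
Open Scope R_scope.

(** * Distances and signed areas *)

Lemma distance_pos (P Q : point) : 0 <= distance P Q.
Proof. unfold distance, dist_euc. apply sqrt_pos. Qed.

Lemma distance_sqr (P Q : point) :
  distance P Q ^ 2 = (fst P - fst Q) ^ 2 + (snd P - snd Q) ^ 2.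
Proof.
  unfold distance, dist_euc. rewrite pow2_sqrt.
  - unfold Rsqr; ring.
  - apply Rplus_le_le_0_compat; apply Rle_0_sqr.
Qed.

Lemma sqr_inj (x y : R) : 0 <= x -> 0 <= y -> x ^ 2 = y ^ 2 -> x = y.
Proof. intros. nra. Qed.

Lemma sqr_eq_cases (x y : R) : x ^ 2 = y ^ 2 -> x = y \/ x = - y.
Proof.
  intros H. assert ((x - y) * (x + y) = 0) by lra.
  destruct (Rmult_integral _ _ H0); [left | right]; lra.
Qed.

Lemma distance_sym (P Q : point) : distance P Q = distance Q P.
Proof.
  apply sqr_inj; try apply distance_pos. rewrite !distance_sqr. ring.
Qed.

Lemma distance_neq0 (P Q : point) : P <> Q -> 0 < distance P Q.
Proof.
  intros H. destruct (Rle_lt_or_eq_dec _ _ (distance_pos P Q)) as [|E]; auto.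
  exfalso; apply H. pose proof (distance_sqr P Q) as D. rewrite <- E in D.
  destruct P as [p1 p2], Q as [q1 q2]; simpl in *.
  destruct (Rplus_sqr_eq_0 (p1 - q1) (p2 - q2)); [unfold Rsqr; lra|].
  f_equal; lra.
Qed.

Lemma cross_neq (P Q S : point) :
  ~ collinear P Q S -> P <> Q /\ Q <> S /\ P <> S.
Proof.
  unfold collinear, cross. intros H.
  repeat split; intros E; apply H; rewrite E; ring.
Qed.

Lemma cross_rot (P Q S : point) : cross P Q S = cross Q S P.
Proof. unfold cross; ring. Qed.

(** * Tangent lengths at the vertices *)

Definition dotp (V W P : point) : R :=
  (fst P - fst V) * (fst W - fst V) + (snd P - snd V) * (snd W - snd V).

(* Signed: it can be negative at a reflex vertex [V]. *)
Definition tangent_length (P V W : point) : R := dotp V W P / distance V W.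

(** The foot of the perpendicular from [P] splits [VW] into these two signed parts. *)
Lemma tangent_length_sum (P V W : point) :
  V <> W -> tangent_length P V W + tangent_length P W V = distance V W.
Proof.
  intros H. apply distance_neq0 in H. unfold tangent_length.
  rewrite (distance_sym W V).
  apply (Rmult_eq_reg_r (distance V W)); [|lra].
  field_simplify; [|lra]. rewrite distance_sqr. unfold dotp. ring.
Qed.

(** Both lengths have square [PV^2 - r^2]. They also agree in sign, since [P] is to the left of both
    [UV] and [VW]: opposite signs would make [U], [V], [W] collinear. *)
Lemma tangent_length_eq (P U V W : point) (r : R) :
  0 < r -> ~ collinear U V W ->
  cross U V P = r * distance U V -> cross V W P = r * distance V W ->
  tangent_length P V W = tangent_length P V U.
Proof.
  intros Hr Hc HU HW.
  destruct (cross_neq _ _ _ Hc) as (NUV & NVW & _).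
  apply distance_neq0 in NUV, NVW. unfold tangent_length.
  rewrite (distance_sym V U).
  pose proof (distance_sqr U V) as DU. pose proof (distance_sqr V W) as DW.
  set (p := distance V W) in *. set (q := distance U V) in *.
  enough (E : dotp V W P * q = dotp V U P * p).
  { apply (Rmult_eq_reg_r (p * q)); [|nra]. field_simplify; lra. }
  destruct U as [u1 u2], V as [v1 v2], W as [w1 w2], P as [p1 p2].
  unfold collinear, cross, dotp in *; cbn [fst snd] in *.
  (* Lagrange's identity: the squared dot product and the squared cross product, here [(r * p)^2],
     add up to the product of the squared lengths. *)
  assert (S1 : ((p1 - v1) * (w1 - v1) + (p2 - v2) * (w2 - v2)) ^ 2
     = p ^ 2 * ((p1 - v1) ^ 2 + (p2 - v2) ^ 2 - r ^ 2)).
  { replace (p ^ 2 * ((p1 - v1) ^ 2 + (p2 - v2) ^ 2 - r ^ 2))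
      with (p ^ 2 * ((p1 - v1) ^ 2 + (p2 - v2) ^ 2) - (r * p) ^ 2) by ring.
    rewrite <- HW, DW. ring. }
  assert (S2 : ((p1 - v1) * (u1 - v1) + (p2 - v2) * (u2 - v2)) ^ 2
     = q ^ 2 * ((p1 - v1) ^ 2 + (p2 - v2) ^ 2 - r ^ 2)).
  { replace (q ^ 2 * ((p1 - v1) ^ 2 + (p2 - v2) ^ 2 - r ^ 2))
      with (q ^ 2 * ((p1 - v1) ^ 2 + (p2 - v2) ^ 2) - (r * q) ^ 2) by ring.
    rewrite <- HU, DU. ring. }
  set (m := (p1 - v1) * (w1 - v1) + (p2 - v2) * (w2 - v2)) in *.
  set (n := (p1 - v1) * (u1 - v1) + (p2 - v2) * (u2 - v2)) in *.
  destruct (sqr_eq_cases (m * q) (n * p)) as [E|E]; auto.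
  { rewrite !Rpow_mult_distr, S1, S2. ring. }
  exfalso. apply Hc.
  (* [z := q (W - V) + p (U - V)] is both orthogonal and parallel to [P - V]. *)
  set (z1 := q * (w1 - v1) + p * (u1 - v1)).
  set (z2 := q * (w2 - v2) + p * (u2 - v2)).
  assert (Z1 : z1 * (p1 - v1) + z2 * (p2 - v2) = 0).
  { unfold z1, z2. unfold m, n in E. lra. }
  assert (Z2 : z1 * (p2 - v2) - z2 * (p1 - v1) = 0).
  { unfold z1, z2.
    transitivity (q * (r * p) - p * (r * q)); [rewrite <- HU, <- HW|]; ring. }
  assert (Hw : 0 < (p1 - v1) ^ 2 + (p2 - v2) ^ 2).
  { apply Rnot_le_lt. intros L.
    destruct (Rplus_sqr_eq_0 (p1 - v1) (p2 - v2)) as [E1 E2].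
    { pose proof (Rle_0_sqr (p1 - v1)). pose proof (Rle_0_sqr (p2 - v2)).
      unfold Rsqr in *. lra. }
    rewrite E1, E2 in HW. pose proof (Rmult_lt_0_compat _ _ Hr NVW). lra. }
  assert (z1 = 0).
  { apply (Rmult_eq_reg_r ((p1 - v1) ^ 2 + (p2 - v2) ^ 2)); [|lra].
    transitivity ((p1 - v1) * (z1 * (p1 - v1) + z2 * (p2 - v2))
      + (p2 - v2) * (z1 * (p2 - v2) - z2 * (p1 - v1))); [ring|].
    rewrite Z1, Z2; ring. }
  assert (z2 = 0).
  { apply (Rmult_eq_reg_r ((p1 - v1) ^ 2 + (p2 - v2) ^ 2)); [|lra].
    transitivity ((p2 - v2) * (z1 * (p1 - v1) + z2 * (p2 - v2))
      - (p1 - v1) * (z1 * (p2 - v2) - z2 * (p1 - v1))); [ring|].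
    rewrite Z1, Z2; ring. }
  apply (Rmult_eq_reg_r q); [|lra].
  transitivity ((v1 - u1) * z2 - (v2 - u2) * z1); [unfold z1, z2; ring|].
  rewrite H, H0; ring.
Qed.

(** * Lines tangent to a circle *)

Lemma tangent_at_distance (P X Y T : point) (r : R) :
  tangent_at P r X Y T -> distance P T = r.
Proof. intros [L H]. apply (H T L). reflexivity. Qed.

Lemma tangent_at_orthogonal (P X Y T : point) (r : R) :
  X <> Y -> tangent_at P r X Y T ->
  (fst T - fst P) * (fst Y - fst X) + (snd T - snd P) * (snd Y - snd X) = 0.
Proof.
  intros N HT. pose proof (tangent_at_distance _ _ _ _ _ HT) as D.
  destruct HT as [[t Ht] H].
  pose proof (distance_neq0 _ _ N) as Hl. pose proof (distance_sqr X Y) as DL.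
  set (l := distance X Y) in *.
  (* The reflection of [T] in the foot of the perpendicular is [T] itself. *)
  set (k := (fst T - fst P) * (fst Y - fst X) + (snd T - snd P) * (snd Y - snd X)).
  set (t' := t - 2 * k / l ^ 2).
  assert (E : comb X Y t' = T).
  { apply H; [exists t'; reflexivity|]. rewrite <- D.
    apply sqr_inj; try apply distance_pos. rewrite !distance_sqr.
    assert (F1 : fst (comb X Y t') = fst T - 2 * k / l ^ 2 * (fst Y - fst X)).
    { rewrite Ht. unfold comb, t'; cbn [fst snd]. ring. }
    assert (F2 : snd (comb X Y t') = snd T - 2 * k / l ^ 2 * (snd Y - snd X)).
    { rewrite Ht. unfold comb, t'; cbn [fst snd]. ring. }
    rewrite F1, F2.
    transitivity ((fst P - fst T) ^ 2 + (snd P - snd T) ^ 2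
      - 4 * (k / l ^ 2) * k + 4 * (k / l ^ 2) ^ 2 * l ^ 2).
    - rewrite DL. unfold k at 3. field. rewrite <- DL. nra.
    - field. lra. }
  rewrite Ht in E. unfold comb in E. injection E as E1 E2.
  assert (K : k / l ^ 2 * l ^ 2 = k) by (field; lra).
  assert (Q1 : k / l ^ 2 * (fst Y - fst X) = 0) by (unfold t' in E1; lra).
  assert (Q2 : k / l ^ 2 * (snd Y - snd X) = 0) by (unfold t' in E2; lra).
  change (k = 0). rewrite <- K, DL.
  transitivity (- (k / l ^ 2 * (fst Y - fst X)) * (fst X - fst Y)
    - (k / l ^ 2 * (snd Y - snd X)) * (snd X - snd Y)); [rewrite DL; ring|].
  rewrite Q1, Q2; ring.
Qed.

(** The radius [PT] is perpendicular to [XY], which fixes the square of the cross product; the sign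
    tells on which side of the line [P] lies. *)
Lemma tangent_at_cross (P X Y T : point) (r : R) :
  X <> Y -> tangent_at P r X Y T ->
  cross X Y P = r * distance X Y \/ cross X Y P = - (r * distance X Y).
Proof.
  intros N HT. apply sqr_eq_cases.
  pose proof (tangent_at_orthogonal _ _ _ _ _ N HT) as O.
  pose proof (tangent_at_distance _ _ _ _ _ HT) as D.
  destruct HT as [[t Ht] _].
  rewrite Rpow_mult_distr, distance_sqr, <- D, distance_sqr.
  assert (E : cross X Y P = (fst Y - fst X) * (snd P - snd T)
                            - (snd Y - snd X) * (fst P - fst T)).
  { rewrite Ht. unfold cross, comb; cbn [fst snd]. ring. }
  rewrite E.
  transitivity (((fst P - fst T) ^ 2 + (snd P - snd T) ^ 2) *
     ((fst X - fst Y) ^ 2 + (snd X - snd Y) ^ 2)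
     - ((fst T - fst P) * (fst Y - fst X) + (snd T - snd P) * (snd Y - snd X)) ^ 2);
    [|rewrite O]; ring.
Qed.

(** By Cauchy-Schwarz. When [P] has signed distance [-r] from the line, the whole disc therefore
    lies weakly to its right. *)
Lemma cross_disc (P X Y Q : point) (r : R) :
  distance P Q <= r -> cross X Y Q <= cross X Y P + r * distance X Y.
Proof.
  intros H.
  enough (E : cross X Y Q - cross X Y P <= distance P Q * distance X Y).
  { pose proof (distance_pos X Y). nra. }
  apply Rsqr_incr_0_var; [|apply Rmult_le_pos; apply distance_pos].
  rewrite Rsqr_mult, !Rsqr_pow2, !distance_sqr. unfold cross.
  match goal with |- ?l <= ?r => enough (0 <= r - l) by lra end.
  apply Rle_trans with (((fst Q - fst P) * (fst Y - fst X)
    + (snd Q - snd P) * (snd Y - snd X)) ^ 2); [apply pow2_ge_0|].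
  apply Req_le. ring.
Qed.

(** Both lines would be perpendicular to the radius [PV], hence parallel. *)
Lemma tangent_common (P V U W T T' : point) (r : R) :
  0 < r -> ~ collinear U V W ->
  tangent_at P r U V T -> tangent_at P r V W T' -> V = T -> V = T' -> False.
Proof.
  intros Hr Hc H1 H2 E1 E2. apply Hc.
  destruct (cross_neq _ _ _ Hc) as (NUV & NVW & _).
  pose proof (tangent_at_distance _ _ _ _ _ H1) as D.
  pose proof (tangent_at_orthogonal _ _ _ _ _ NUV H1) as O1.
  pose proof (tangent_at_orthogonal _ _ _ _ _ NVW H2) as O2.
  rewrite <- E1 in *; rewrite <- E2 in *.
  pose proof (distance_sqr P V) as DS. rewrite D in DS.
  unfold collinear.
  apply (Rmult_eq_reg_r (r ^ 2)); [|nra].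
  rewrite DS, Rmult_0_l. unfold cross.
  set (m := fst V - fst P) in *. set (n := snd V - snd P) in *.
  replace ((fst P - fst V)) with (- m) by (unfold m; ring).
  replace ((snd P - snd V)) with (- n) by (unfold n; ring).
  transitivity
   (((m * (fst V - fst U) + n * (snd V - snd U)) *
     (m * (snd W - snd V) - n * (fst W - fst V))
    - (m * (fst W - fst V) + n * (snd W - snd V)) *
      (m * (snd V - snd U) - n * (fst V - fst U)))); [ring|].
  rewrite O1, O2; ring.
Qed.

(** * Orientation of the quadrilateral *)

Lemma segments_cross (X Y Z W : point) :
  cross X Y Z * cross X Y W < 0 -> cross Z W X * cross Z W Y < 0 ->
  exists Q, interior_of_segment X Y Q /\ interior_of_segment Z W Q.
Proof.
  intros H1 H2.
  (* [p / (p - q)] is the zero of the affine function with values [p] at 0 and [q] at 1. *)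
  assert (forall p q, p * q < 0 -> 0 < p / (p - q) < 1 /\ p - q <> 0) as F.
  { intros p q H. assert (p - q <> 0) by nra. split; auto.
    assert (p / (p - q) = p ^ 2 / (p ^ 2 - p * q)) as ->
      by (field; split; nra).
    split; [apply Rdiv_lt_0_compat; nra|].
    apply (Rmult_lt_reg_r (p ^ 2 - p * q)); [nra|].
    field_simplify; nra. }
  destruct (F _ _ H1) as [F1 G1], (F _ _ H2) as [F2 G2].
  set (t := cross Z W X / (cross Z W X - cross Z W Y)) in *.
  set (t' := cross X Y Z / (cross X Y Z - cross X Y W)) in *.
  exists (comb X Y t). split; [exists t; auto|]. exists t'. split; auto.
  assert (G3 : cross X Y Z - cross X Y W = - (cross Z W X - cross Z W Y))
    by (unfold cross; ring).
  unfold t, t'. rewrite G3.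
  assert (G4 : forall (n x y m z w D : R), D <> 0 ->
    (D - n) * x + n * y = (D + m) * z - m * w ->
    (1 - n / D) * x + n / D * y = (1 - m / - D) * z + m / - D * w).
  { intros n x y m z w D HD E.
    transitivity (((D - n) * x + n * y) / D); [field; auto|].
    rewrite E. field; auto. }
  unfold comb. f_equal; apply G4; auto; unfold cross; ring.
Qed.

(** In the convex case no vertex is reflex. In the concave case [cross A B C < 0], and a negative
    [OAB] or [OBC] would make two opposite sides cross. *)
Lemma quadrilateral_cross_pos (O A B C : point) :
  quadrilateral O A B C ->
  0 < cross O A B /\ 0 < cross O B C /\ 0 < cross O A C.
Proof.
  intros [N1 N2 N3 N4 Hs Hp Hl].
  unfold collinear in *. unfold signed_area in Hp.
  assert (S : cross O A B + cross O B C = cross O A C + cross A B C)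
    by (unfold cross; ring).
  (* [I1] excludes a crossing of [OA] with [BC], and [I2] one of [AB] with [CO]. *)
  assert (I1 : cross O A B * cross O A C < 0 ->
               cross O B C * cross A B C < 0 -> False).
  { intros J1 J2. destruct (segments_cross O A B C) as [Q [Q1 Q2]]; auto.
    { replace (cross B C O) with (cross O B C) by (unfold cross; ring).
      replace (cross B C A) with (cross A B C) by (unfold cross; ring). auto. }
    inversion Hs as [|? ? F _]; subst. inversion F as [|? ? _ F']; subst.
    inversion F' as [|? ? F'' _]; subst. apply (F'' Q). auto. }
  assert (I2 : cross A B C * cross O A B < 0 ->
               cross O A C * cross O B C < 0 -> False).
  { intros J1 J2. destruct (segments_cross A B C O) as [Q [Q1 Q2]]; auto.
    { replace (cross A B O) with (cross O A B) by (unfold cross; ring). auto. }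
    { replace (cross C O A) with (cross O A C) by (unfold cross; ring).
      replace (cross C O B) with (cross O B C) by (unfold cross; ring). auto. }
    inversion Hs as [|? ? _ F]; subst. inversion F as [|? ? F' _]; subst.
    inversion F' as [|? ? _ F'']; subst. inversion F'' as [|? ? F3 _]; subst.
    apply (F3 Q). auto. }
  destruct (classic (concave O A B C)) as [Hc|Hc].
  - specialize (Hl Hc). unfold reflex in Hl.
    destruct (Rtotal_order (cross O A B) 0) as [|[|]]; [exfalso; apply I1; nra|lra|].
    destruct (Rtotal_order (cross O B C) 0) as [|[|]]; [exfalso; apply I2; nra|lra|].
    lra.
  - unfold concave, reflex in Hc.
    replace (cross C O A) with (cross O A C) in Hc by (unfold cross; ring).
    replace (cross B C O) with (cross O B C) in Hc by (unfold cross; ring).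
    repeat split; apply Rnot_le_lt; intros [L|L]; tauto.
Qed.

(** * Position of the incircle relative to the sides *)

Lemma cross_combination (X Y P Q S : point) (u v w : R) :
  u + v + w = 1 ->
  cross X Y (u * fst P + v * fst Q + w * fst S, u * snd P + v * snd Q + w * snd S)
  = u * cross X Y P + v * cross X Y Q + w * cross X Y S.
Proof.
  intros H. unfold cross; cbn [fst snd].
  replace u with (1 - v - w) by lra. ring.
Qed.

Lemma cross_on_line (X Y Q : point) : on_line X Y Q -> cross X Y Q = 0.
Proof. intros [t ->]. unfold cross, comb; cbn [fst snd]. ring. Qed.

Lemma cross_degenerate (X Y : point) : cross X Y X = 0 /\ cross X Y Y = 0.
Proof. unfold cross; split; ring. Qed.

(** Only [OA] and [CO] are treated: with a reflex angle at [B] the region extends across the lines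
    [AB] and [BC]. *)
Lemma region_cross_nonneg (O A B C X : point) :
  0 < cross O A B -> 0 < cross O B C -> 0 < cross O A C ->
  region O A B C X -> 0 <= cross O A X /\ 0 <= cross C O X.
Proof.
  intros H1 H2 H3.
  destruct (cross_degenerate O A), (cross_degenerate C O).
  assert (cross C O A = cross O A C) by (unfold cross; ring).
  assert (cross C O B = cross O B C) by (unfold cross; ring).
  intros [(u & v & w & Hu & Hv & Hw & S & ->)|(u & v & w & Hu & Hv & Hw & S & ->)];
    rewrite !cross_combination by assumption; split; nra.
Qed.

(** The region meets the line [OA] in the segment [OA], on which [cross A B] is positive except at
    [A]. *)
Lemma region_edge_OA (O A B C X : point) :
  0 < cross O A B -> 0 < cross O B C -> 0 < cross O A C ->
  region O A B C X -> cross O A X = 0 -> cross A B X <= 0 -> X = A.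
Proof.
  intros H1 H2 H3.
  destruct (cross_degenerate O A), (cross_degenerate A B).
  assert (cross A B O = cross O A B) by (unfold cross; ring).
  intros [(u & v & w & Hu & Hv & Hw & S & ->)|(u & v & w & Hu & Hv & Hw & S & ->)];
    rewrite !cross_combination by assumption; intros E L.
  - assert (w = 0) by nra. assert (u = 0) by nra. assert (v = 1) by lra. subst.
    destruct A; simpl; f_equal; ring.
  - assert (v = 0) by nra. assert (w = 0) by nra. assert (u = 1) by lra. subst.
    nra.
Qed.

Lemma region_edge_CO (O A B C X : point) :
  0 < cross O A B -> 0 < cross O B C -> 0 < cross O A C ->
  region O A B C X -> cross C O X = 0 -> cross B C X <= 0 -> X = C.
Proof.
  intros H1 H2 H3.
  destruct (cross_degenerate C O), (cross_degenerate B C).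
  assert (cross B C O = cross O B C) by (unfold cross; ring).
  assert (cross C O A = cross O A C) by (unfold cross; ring).
  assert (cross C O B = cross O B C) by (unfold cross; ring).
  intros [(u & v & w & Hu & Hv & Hw & S & ->)|(u & v & w & Hu & Hv & Hw & S & ->)];
    rewrite !cross_combination by assumption; intros E L.
  - assert (v = 0) by nra. assert (w = 0) by nra. assert (u = 1) by lra. subst.
    nra.
  - assert (v = 0) by nra. assert (u = 0) by nra. assert (w = 1) by lra. subst.
    destruct C; simpl; f_equal; ring.
Qed.

Lemma on_line_start (X Y : point) : on_line X Y X.
Proof. exists 0. destruct X, Y; unfold comb; simpl; f_equal; ring. Qed.

Lemma on_line_end (X Y : point) : on_line X Y Y.
Proof. exists 1. destruct X, Y; unfold comb; simpl; f_equal; ring. Qed.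

Lemma distance_self (P : point) : distance P P = 0.
Proof.
  apply sqr_inj; [apply distance_pos|lra|]. rewrite distance_sqr. ring.
Qed.

(* If [P] were on the right of [AB], so would be the whole disc; but the tangency
   point on [OA] lies in the region, hence would be [A], a common tangency
   point of two different lines. The same works for [BC], [CO] and [C]. *)
Lemma incircle_cross (O A B C P : point) (r : R) :
  quadrilateral O A B C -> incircle O A B C P r ->
  cross O A P = r * distance O A /\ cross A B P = r * distance A B /\
  cross B C P = r * distance B C /\ cross C O P = r * distance C O.
Proof.
  intros Hq (Hr & Hd & Ht).
  destruct (quadrilateral_cross_pos _ _ _ _ Hq) as (H1 & H2 & H3).
  destruct Hq as [N1 N2 N3 N4 _ _ _].
  destruct (cross_neq _ _ _ N1) as (D1 & D2 & D3).
  destruct (cross_neq _ _ _ N3) as (D4 & D5 & D6).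
  destruct (Ht O A) as (T1 & HT1 & _); [simpl; auto|].
  destruct (Ht A B) as (T2 & HT2 & _); [simpl; auto|].
  destruct (Ht B C) as (T3 & HT3 & _); [simpl; auto|].
  destruct (Ht C O) as (T4 & HT4 & _); [simpl; auto|].
  assert (N3' : ~ collinear B C O).
  { unfold collinear in *. rewrite <- cross_rot. auto. }
  assert (D6' : C <> O) by auto.
  pose proof (distance_neq0 _ _ D1). pose proof (distance_neq0 _ _ D6').
  (* The centre belongs to the disc, hence to the region; this settles the signs for [OA] and
     [CO]. *)
  assert (RP : region O A B C P).
  { apply Hd. rewrite distance_self. lra. }
  destruct (region_cross_nonneg _ _ _ _ _ H1 H2 H3 RP) as [P1 P4].
  repeat split.
  - destruct (tangent_at_cross _ _ _ _ _ D1 HT1) as [|E]; auto. nra.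
  - destruct (tangent_at_cross _ _ _ _ _ D2 HT2) as [|E]; auto. exfalso.
    pose proof (tangent_at_distance _ _ _ _ _ HT1) as DT.
    assert (T1 = A) as ->.
    { apply (region_edge_OA O A B C); auto.
      - apply Hd; lra.
      - apply cross_on_line, HT1.
      - pose proof (cross_disc P A B T1 r). lra. }
    apply (tangent_common P A O B A T2 r); auto.
    apply (proj2 HT2); auto using on_line_start.
  - destruct (tangent_at_cross _ _ _ _ _ D5 HT3) as [|E]; auto. exfalso.
    pose proof (tangent_at_distance _ _ _ _ _ HT4) as DT.
    assert (T4 = C) as ->.
    { apply (region_edge_CO O A B C); auto.
      - apply Hd; lra.
      - apply cross_on_line, HT4.
      - pose proof (cross_disc P B C T4 r). lra. }
    apply (tangent_common P C B O T3 C r); auto.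
    apply (proj2 HT3); auto using on_line_end.
  - destruct (tangent_at_cross _ _ _ _ _ D6' HT4) as [|E]; auto. nra.
Qed.

(** Pitot's theorem: each sum of opposite sides contains one tangent length from every vertex.
    Signed lengths cover the reflex vertex as well. *)
Lemma tangential_side_sums (O A B C : point) :
  quadrilateral O A B C -> tangential O A B C ->
  distance O A + distance B C = distance A B + distance C O.
Proof.
  intros Hq (P & r & Hi).
  destruct (incircle_cross _ _ _ _ _ _ Hq Hi) as (E1 & E2 & E3 & E4).
  destruct Hi as (Hr & _). destruct Hq as [N1 N2 N3 N4 _ _ _].
  assert (N3' : ~ collinear B C O).
  { unfold collinear in *. rewrite <- cross_rot. auto. }
  assert (N2' : ~ collinear C O A).
  { unfold collinear in *. rewrite cross_rot. auto. }
  destruct (cross_neq _ _ _ N1) as (D1 & D2 & _).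
  destruct (cross_neq _ _ _ N3') as (D3 & D4 & _).
  rewrite <- (tangent_length_sum P O A), <- (tangent_length_sum P A B),
    <- (tangent_length_sum P B C), <- (tangent_length_sum P C O) by assumption.
  rewrite (tangent_length_eq P C O A r), (tangent_length_eq P O A B r),
    (tangent_length_eq P A B C r), (tangent_length_eq P B C O r) by assumption.
  ring.
Qed.

(** * Metric relations between sides and diagonals *)

Lemma heron (X Y Z : point) :
  4 * cross X Y Z ^ 2 =
  ((distance X Y + distance Y Z) ^ 2 - distance X Z ^ 2) *
  (distance X Z ^ 2 - (distance X Y - distance Y Z) ^ 2).
Proof.
  transitivity (4 * distance X Y ^ 2 * distance Y Z ^ 2
    - (distance X Y ^ 2 + distance Y Z ^ 2 - distance X Z ^ 2) ^ 2); [|ring].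
  rewrite !distance_sqr. unfold cross. ring.
Qed.

(** Lagrange's identity for the vectors [OB] and [AC]: their cross product is twice the signed area,
    and their dot product is half the alternating sum of the squared sides. *)
Lemma bretschneider (O A B C : point) :
  (cross O A B + cross O B C) ^ 2
  + ((distance A B ^ 2 + distance C O ^ 2 - distance O A ^ 2 - distance B C ^ 2) / 2) ^ 2
  = distance O B ^ 2 * distance A C ^ 2.
Proof. rewrite !distance_sqr. unfold cross. field. Qed.

(** Since [a - b = d - c], Heron's formula for [OAB] and for [OBC] shares the factor [16 y].
    Subtracting the two gives the area of [OAB] linearly in [y]; inserting it back gives the
    quadratic. *)
Lemma diagonal_quadratic (O A B C : point) (a b c d y : R) :
  distance O A = a -> distance A B = b -> distance B C = c -> distance C O = d ->
  0 < a + c -> a + c = b + d ->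
  cross O A B + cross O B C = 4 * (a + c) ->
  distance O B ^ 2 = (a - b) ^ 2 + 16 * y ->
  cross O A B = 2 * (a + c) + 2 * (a - d) * y /\
  y ^ 2 * (16 + (a - d) ^ 2) - 2 * y * (a * b + c * d) + (a + c) ^ 2 = 0.
Proof.
  intros Ha Hb Hc Hd Hp Hs HA HP.
  pose proof (heron O A B) as E1. pose proof (heron O B C) as E2.
  assert (E2' : 4 * cross O B C ^ 2 =
    ((distance B C + distance C O) ^ 2 - distance O B ^ 2) *
    (distance O B ^ 2 - (distance B C - distance C O) ^ 2)).
  { rewrite E2, (distance_sym O C). ring. }
  clear E2. rewrite HP, Ha, Hb in E1. rewrite HP, Hc, Hd in E2'.
  set (x1 := cross O A B) in *. set (x2 := cross O B C) in *.
  assert (F1 : x1 ^ 2 = 16 * y * (a * b - 4 * y)) by lra.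
  assert (Ec : c = b + d - a) by lra. clear Hc; subst c.
  (* [x1^2 - x2^2 = 16 y (ab - cd)], and [ab - cd = (a - d)(b + d)]. *)
  assert (D : x1 - x2 = 4 * (a - d) * y).
  { apply (Rmult_eq_reg_r (4 * (b + d))); [|lra].
    transitivity (x1 ^ 2 - x2 ^ 2); [|lra].
    replace (4 * (b + d)) with (x1 + x2) by lra. ring. }
  assert (G : x1 = 2 * (a + (b + d - a)) + 2 * (a - d) * y) by lra.
  split; [exact G|]. rewrite G in F1. lra.
Qed.

Lemma diagonal_relations (O A B C : point) (a b c d y z : R) :
  distance O A = a -> distance A B = b -> distance B C = c -> distance C O = d ->
  0 < a + c -> a + c = b + d ->
  cross O A B + cross O B C = 4 * (a + c) ->
  distance O B ^ 2 = (a - b) ^ 2 + 16 * y ->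
  distance A C ^ 2 = (a - d) ^ 2 + 16 * z ->
  y * z = y + z /\
  16 * (y * z) + y * (a - d) ^ 2 + z * (a - b) ^ 2 = (a + c) ^ 2 /\
  y ^ 2 * (16 + (a - d) ^ 2) - 2 * y * (a * b + c * d) + (a + c) ^ 2 = 0 /\
  z ^ 2 * (16 + (a - b) ^ 2) - 2 * z * (a * d + b * c) + (a + c) ^ 2 = 0 /\
  distance O B ^ 2 * cross O A C - a ^ 2 * cross O B C - d ^ 2 * cross O A B
  = 2 * (a + c) * (y * (16 + (a - d) ^ 2) - (a * b + c * d)).
Proof.
  intros Ha Hb Hc Hd Hp Hs HA HP HQ.
  destruct (diagonal_quadratic O A B C a b c d y) as [X1 Qy]; auto.
  assert (S : cross O A B + cross O B C = cross O A C + cross A B C)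
    by (unfold cross; ring).
  (* The cyclic shift of the vertices exchanges the two diagonals. *)
  destruct (diagonal_quadratic A B C O b c d a z) as [X4 Qz]; auto; try lra.
  { replace (cross A C O) with (cross O A C) by (unfold cross; ring). lra. }
  { rewrite HQ. replace (b - c) with (a - d) by lra. ring. }
  assert (X2 : cross O B C = 2 * (a + c) - 2 * (a - d) * y) by lra.
  assert (X3 : cross O A C = 2 * (a + c) + 2 * (a - b) * z) by lra.
  (* Here the dot product of the diagonals is [-(a - b)(a - d)], so its square cancels against the
     product of the squared differences. *)
  pose proof (bretschneider O A B C) as Br.
  rewrite HA, HP, HQ, Ha, Hb, Hc, Hd in Br.
  assert (E : 16 * (y * z) + y * (a - d) ^ 2 + z * (a - b) ^ 2 = (a + c) ^ 2).
  { assert (Ec : c = b + d - a) by lra. clear Hc; subst c. lra. }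
  (* The relation [cross O B C * A - cross O A C * B + cross O A B * C = 0]
     between the vectors from [O], dotted with [A]. *)
  assert (V : 2 * distance O A ^ 2 * cross O B C
    - (distance O A ^ 2 + distance O B ^ 2 - distance A B ^ 2) * cross O A C
    + (distance O A ^ 2 + distance C O ^ 2 - distance A C ^ 2) * cross O A B = 0).
  { rewrite !distance_sqr. unfold cross. ring. }
  rewrite HP, HQ, Ha, Hb, Hd, X1, X2, X3 in V.
  split; [|split; [exact E|split; [exact Qy|split]]].
  - assert (Ec : c = b + d - a) by lra. clear Hc; subst c.
    apply (Rmult_eq_reg_l (b + d)); [|lra].
    (* [W] is [V] expanded, up to a constant factor. Replacing [(b + d)^2] by means of [E] leaves a
       multiple of [(b + d)(y z - y - z) = 0]. *)
    assert (W : (b + d) ^ 2 * a =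
       ((a - d) ^ 2 * a + 8 * (b + d)) * y + ((a - b) ^ 2 * a + 8 * (b + d)) * z
        + 8 * (2 * a - b - d) * (y * z)) by lra.
    replace ((b + d) ^ 2) with
      (16 * (y * z) + y * (a - d) ^ 2 + z * (a - b) ^ 2) in W
      by (rewrite E; ring).
    lra.
  - rewrite <- Hs in Qz. lra.
  - rewrite HP, X1, X2, X3.
    transitivity (2 * (a + c) * ((a - b) ^ 2 - a ^ 2 - d ^ 2 + 16 * y)
      + 2 * (a - b) * (z * (a - b) ^ 2 + 16 * (y * z))
      + 2 * (a - d) * y * (a ^ 2 - d ^ 2)); [ring|].
    replace (z * (a - b) ^ 2 + 16 * (y * z)) with ((a + c) ^ 2 - y * (a - d) ^ 2) by lra.
    assert (Ec : c = b + d - a) by lra. clear Hc; subst c. ring.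
Qed.

(** * The circumcircle test and the sign in [quad_delta] *)

(** The expression is the in-circle determinant: for a circumcentre [K] it equals [cross O A C]
    times the power of [B]. *)
Lemma within_circumcircle_iff (O A B C : point) :
  0 < cross O A C ->
  (within_circumcircle O A C B <->
   distance O B ^ 2 * cross O A C - distance O A ^ 2 * cross O B C
   - distance C O ^ 2 * cross O A B < 0).
Proof.
  intros H3.
  assert (E : forall K, distance K A = distance K O -> distance K C = distance K O ->
    distance O B ^ 2 * cross O A C - distance O A ^ 2 * cross O B C
    - distance C O ^ 2 * cross O A B
    = cross O A C * (distance K B ^ 2 - distance K O ^ 2)).
  { intros K E1 E2.
    apply (f_equal (fun x => x ^ 2)) in E1. apply (f_equal (fun x => x ^ 2)) in E2.
    rewrite !distance_sqr in *. unfold cross in *.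
    assert (F1 : (fst K - fst A) ^ 2 + (snd K - snd A) ^ 2
      - ((fst K - fst O) ^ 2 + (snd K - snd O) ^ 2) = 0) by lra.
    assert (F2 : (fst K - fst C) ^ 2 + (snd K - snd C) ^ 2
      - ((fst K - fst O) ^ 2 + (snd K - snd O) ^ 2) = 0) by lra.
    match goal with |- ?l = ?r => enough (l - r = 0) by lra end.
    transitivity (
      - cross O B C * ((fst K - fst A) ^ 2 + (snd K - snd A) ^ 2
      - ((fst K - fst O) ^ 2 + (snd K - snd O) ^ 2))
      - cross O A B * ((fst K - fst C) ^ 2 + (snd K - snd C) ^ 2
      - ((fst K - fst O) ^ 2 + (snd K - snd O) ^ 2))); [unfold cross; ring|].
    rewrite F1, F2; ring. }
  split.
  - intros (K & E1 & E2 & L). rewrite (E K E1 E2).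
    pose proof (distance_pos K B).
    assert (distance K B ^ 2 < distance K O ^ 2) by nra. nra.
  - intros L.
    set (a1 := fst A - fst O). set (a2 := snd A - snd O).
    set (c1 := fst C - fst O). set (c2 := snd C - snd O).
    set (x := cross O A C).
    (* The circumcentre, from Cramer's rule for the two perpendicular bisectors through [O A] and
       [O C], with [O] as origin. *)
    set (K := (fst O + ((a1 ^ 2 + a2 ^ 2) * c2 - (c1 ^ 2 + c2 ^ 2) * a2) / (2 * x),
               snd O + ((c1 ^ 2 + c2 ^ 2) * a1 - (a1 ^ 2 + a2 ^ 2) * c1) / (2 * x))).
    assert (Hx : x = a1 * c2 - a2 * c1) by reflexivity.
    assert (E1 : distance K A = distance K O).
    { apply sqr_inj; try apply distance_pos. rewrite !distance_sqr.
      unfold K; cbn [fst snd].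
      replace (fst A) with (fst O + a1) by (unfold a1; ring).
      replace (snd A) with (snd O + a2) by (unfold a2; ring).
      rewrite Hx. field. rewrite <- Hx. unfold x; lra. }
    assert (E2 : distance K C = distance K O).
    { apply sqr_inj; try apply distance_pos. rewrite !distance_sqr.
      unfold K; cbn [fst snd].
      replace (fst C) with (fst O + c1) by (unfold c1; ring).
      replace (snd C) with (snd O + c2) by (unfold c2; ring).
      rewrite Hx. field. rewrite <- Hx. unfold x; lra. }
    exists K. split; [exact E1|split; [exact E2|]].
    rewrite (E K E1 E2) in L.
    pose proof (distance_pos K B). pose proof (distance_pos K O).
    apply Rnot_le_lt. intros M. fold x in L, H3.
    assert (distance K O ^ 2 <= distance K B ^ 2) by nra. nra.
Qed.

Lemma sqrt_root (w R2 : R) : 0 <= w -> w ^ 2 = 4 * R2 -> 2 * sqrt R2 = w.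
Proof.
  intros H E. replace R2 with ((w / 2) ^ 2) by lra.
  rewrite sqrt_pow2; lra.
Qed.

Lemma sigma_tau_values (O A B C : point) (a b c d y z : R) :
  0 < cross O A C ->
  distance O A = a -> distance A B = b -> distance B C = c -> distance C O = d ->
  0 < a + c -> a + c = b + d ->
  cross O A B + cross O B C = 4 * (a + c) ->
  distance O B ^ 2 = (a - b) ^ 2 + 16 * y ->
  distance A C ^ 2 = (a - d) ^ 2 + 16 * z ->
  quad_sigma O A B C = z /\ quad_tau O A B C = y.
Proof.
  intros H3 Ha Hb Hc Hd Hp Hs HA HP HQ.
  destruct (diagonal_relations O A B C a b c d y z) as (E1 & E2 & Qy & Qz & D); auto.
  pose proof (within_circumcircle_iff O A B C H3) as W.
  rewrite Ha, Hd, D in W.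
  set (w := y * (16 + (a - d) ^ 2) - (a * b + c * d)) in *.
  (* [w^2] is a quarter of the discriminant of the quadratic for [y]. *)
  assert (Ew : w ^ 2 = 4 * (a * b * c * d - 4 * (a + c) ^ 2)).
  { transitivity ((16 + (a - d) ^ 2) *
     (y ^ 2 * (16 + (a - d) ^ 2) - 2 * y * (a * b + c * d) + (a + c) ^ 2)
     + (a * b + c * d) ^ 2 - (16 + (a - d) ^ 2) * (a + c) ^ 2); [unfold w; ring|].
    rewrite Qy. assert (Ec : c = b + d - a) by lra. clear Hc; subst c. ring. }
  (* By [E1] and [E2], the left side and [w] add up to [(a + c)^2 - (a + c)(b + d) = 0]. *)
  assert (Ez : z * (16 + (a - b) ^ 2) - (a * d + b * c) = - w).
  { unfold w. assert (Ec : c = b + d - a) by lra. clear Hc; subst c. lra. }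
  (* The determinant is [2 (a + c) w], so [w < 0] exactly when [B] is within the circle. *)
  assert (Hdelta : 2 * quad_delta O A B C * sqrt (a * b * c * d - 4 * (a + c) ^ 2) = - w).
  { unfold quad_delta.
    destruct (excluded_middle_informative (within_circumcircle O A C B)) as [I|I].
    - apply W in I. assert (w < 0) by nra.
      pose proof (sqrt_root (- w) (a * b * c * d - 4 * (a + c) ^ 2)). lra.
    - assert (0 <= w).
      { apply Rnot_lt_le. intros L. apply I, W. nra. }
      pose proof (sqrt_root w (a * b * c * d - 4 * (a + c) ^ 2)). lra. }
  unfold quad_sigma, quad_tau. rewrite Ha, Hb, Hc, Hd, Hdelta.
  pose proof (pow2_ge_0 (a - b)). pose proof (pow2_ge_0 (a - d)).
  split.
  - apply (Rmult_eq_reg_r (16 + (a - b) ^ 2)); [|lra].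
    field_simplify; lra.
  - apply (Rmult_eq_reg_r (16 + (a - d) ^ 2)); [|lra].
    unfold w. field_simplify; lra.
Qed.

(** * Integrality of the sides *)

Lemma lattice_distance_sqr (P Q : point) :
  lattice_point P -> lattice_point Q -> exists n : Z, distance P Q ^ 2 = IZR n.
Proof.
  intros (p1 & p2 & ->) (q1 & q2 & ->). rewrite distance_sqr; cbn [fst snd].
  exists ((p1 - q1) ^ 2 + (p2 - q2) ^ 2)%Z.
  replace ((p1 - q1) ^ 2 + (p2 - q2) ^ 2)%Z
    with ((p1 - q1) * (p1 - q1) + (p2 - q2) * (p2 - q2))%Z by ring.
  rewrite plus_IZR, !mult_IZR, !minus_IZR. ring.
Qed.

Lemma lattice_cross (P Q S : point) :
  lattice_point P -> lattice_point Q -> lattice_point S ->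
  exists n : Z, cross P Q S = IZR n.
Proof.
  intros (p1 & p2 & ->) (q1 & q2 & ->) (s1 & s2 & ->). unfold cross; cbn [fst snd].
  exists ((q1 - p1) * (s2 - p2) - (q2 - p2) * (s1 - p1))%Z.
  rewrite minus_IZR, !mult_IZR, !minus_IZR. ring.
Qed.

(** After division by the gcd, Gauss's lemma makes [n'] a divisor of [m'], hence of 1. *)
Lemma square_divide (n m k : Z) : (n <> 0 -> m * m = k * (n * n) -> (n | m))%Z.
Proof.
  intros Hn E. destruct (Z.gcd_divide_l n m) as [n' En].
  destruct (Z.gcd_divide_r n m) as [m' Em].
  set (g := Z.gcd n m) in *.
  assert (Hg : g <> 0%Z) by (intros G; rewrite G in En; lia).
  assert (Hc : Z.gcd n' m' = 1%Z).
  { assert (Z.gcd (n' * g) (m' * g) = g) as G by (rewrite <- En, <- Em; reflexivity).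
    rewrite Z.gcd_mul_mono_r_nonneg in G by apply Z.gcd_nonneg. nia. }
  assert (E' : (m' * m' = k * (n' * n'))%Z).
  { apply (Z.mul_reg_r _ _ (g * g)); [nia|].
    rewrite En, Em in E. lia. }
  assert (n' | m')%Z.
  { apply (Z.gauss n' m' m'); [|exact Hc]. exists (k * n')%Z. lia. }
  assert (n' | 1)%Z.
  { rewrite <- Hc. apply Z.gcd_greatest; [apply Z.divide_refl|assumption]. }
  apply Z.divide_1_r in H0. rewrite En, Em.
  apply Z.mul_divide_mono_r. assumption.
Qed.

Lemma rational_root_integer (x : R) (n m k : Z) :
  (n <> 0)%Z -> IZR n * x = IZR m -> x ^ 2 = IZR k -> exists l : Z, x = IZR l.
Proof.
  intros Hn E1 E2. destruct (square_divide n m k Hn) as [l El].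
  { apply eq_IZR. rewrite !mult_IZR, <- E1, <- E2. ring. }
  exists l. apply (Rmult_eq_reg_l (IZR n)).
  - rewrite E1, El, mult_IZR. ring.
  - apply not_0_IZR; auto.
Qed.

(** [x - y = (x^2 - y^2) / (x + y)] is rational, hence so is [x]. This is meant for opposite sides,
    whose sum is a quarter of an integer. *)
Lemma sum_of_roots_integer (x y : R) (p q n : Z) :
  0 < x + y -> x ^ 2 = IZR p -> y ^ 2 = IZR q -> 4 * (x + y) = IZR n ->
  exists l : Z, x = IZR l.
Proof.
  intros Hp Hx Hy Hn.
  apply (rational_root_integer x (8 * n) (n * n + 16 * (p - q)) p); auto.
  - intros E. assert (n = 0%Z) by lia. subst n. lra.
  - rewrite plus_IZR, !mult_IZR, minus_IZR, <- Hx, <- Hy, <- Hn. ring.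
Qed.

(** * Arithmetic of the factorizations of 256 *)

Lemma divisors_256 (m k : Z) : (0 < m -> m * k = 256 ->
  In m [1; 2; 4; 8; 16; 32; 64; 128; 256])%Z.
Proof.
  intros Hm E.
  assert (Hk : (0 < k)%Z) by nia. assert (Hm' : (m <= 256)%Z) by nia.
  (* Exhaustive check of 1 to 256; the index [n] stands for the candidate [S n]. *)
  assert (F : forallb (fun n : nat => let i := Z.of_nat (S n) in
     orb (negb (Z.eqb (256 mod i) 0))
       (existsb (Z.eqb i) [1; 2; 4; 8; 16; 32; 64; 128; 256]%Z)) (seq 0 256) = true)
    by (vm_compute; reflexivity).
  rewrite forallb_forall in F.
  specialize (F (Z.to_nat (m - 1))). cbv zeta in F.
  replace (Z.of_nat (S (Z.to_nat (m - 1)))) with m in F by lia.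
  replace (256 mod m)%Z with 0%Z in F.
  - rewrite Z.eqb_refl in F. simpl negb in F. rewrite Bool.orb_false_l in F.
    destruct (proj1 (existsb_exists _ _) (F ltac:(apply in_seq; lia))) as (i & Hi & Ei).
    apply Z.eqb_eq in Ei. subst i. exact Hi.
  - rewrite <- E, Z.mul_comm, Z_mod_mult. reflexivity.
Qed.

(** Modulo 16 the equation forces [u = 4 q]. After division by 16, the terms in [v] cancel modulo 4
    and leave [1 + q^2], which is never divisible by 4. *)
Lemma ratio_16_impossible (a u v : Z) :
  (16 * (2 * a - u - v) ^ 2 = 17 * (272 + 16 * v ^ 2 + u ^ 2) -> False)%Z.
Proof.
  intros E.
  pose proof (Z.div_mod u 4 ltac:(lia)) as Hu.
  pose proof (Z.mod_pos_bound u 4 ltac:(lia)) as Br.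
  set (q := (u / 4)%Z) in *. set (r := (u mod 4)%Z) in *.
  assert (r = 0 \/ r = 1 \/ r = 2 \/ r = 3)%Z as [R0|[R0|[R0|R0]]] by lia;
    rewrite R0 in Hu; rewrite Hu in E; [|exfalso; lia..].
  destruct (Z.Even_or_Odd q) as [[t Ht]|[t Ht]]; rewrite Ht in E; lia.
Qed.

Theorem lemma6 (O A B C : point)
  (hLEQ : LEQ O A B C) (htan : tangential O A B C) :
  same_pair (quad_sigma O A B C) (quad_tau O A B C) 9 (9 / 8) \/
  same_pair (quad_sigma O A B C) (quad_tau O A B C) 5 (5 / 4) \/
  same_pair (quad_sigma O A B C) (quad_tau O A B C) 3 (3 / 2) \/
  same_pair (quad_sigma O A B C) (quad_tau O A B C) 2 2.
Proof.
  destruct hLEQ as [Hq LO LA LB LC He].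
  pose proof (tangential_side_sums _ _ _ _ Hq htan) as Hs.
  destruct (quadrilateral_cross_pos _ _ _ _ Hq) as (_ & _ & H3).
  assert (Hp : 0 < distance O A + distance B C).
  { destruct (cross_neq _ _ _ (quad_OAC _ _ _ _ Hq)) as (D & _ & _).
    apply distance_neq0 in D. pose proof (distance_pos B C). lra. }
  (* Twice the area is twice the perimeter, and the perimeter is twice the sum of two opposite
     sides. *)
  assert (HA : cross O A B + cross O B C = 4 * (distance O A + distance B C)).
  { pose proof (quad_positive _ _ _ _ Hq) as Ha.
    unfold area, perimeter in He. rewrite Rabs_pos_eq in He by lra.
    unfold signed_area in He. lra. }
  destruct (lattice_distance_sqr O A) as [na Na]; auto.
  destruct (lattice_distance_sqr A B) as [nb Nb]; auto.
  destruct (lattice_distance_sqr B C) as [nc Nc]; auto.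
  destruct (lattice_distance_sqr C O) as [nd Nd]; auto.
  destruct (lattice_distance_sqr O B) as [np Np]; auto.
  destruct (lattice_distance_sqr A C) as [nq Nq]; auto.
  destruct (lattice_cross O A B) as [x1 X1]; auto.
  destruct (lattice_cross O B C) as [x2 X2]; auto.
  assert (Hn : 4 * (distance O A + distance B C) = IZR (x1 + x2))
    by (rewrite plus_IZR; lra).
  destruct (sum_of_roots_integer (distance O A) (distance B C) na nc (x1 + x2))
    as [a Ia]; auto; try lra.
  destruct (sum_of_roots_integer (distance A B) (distance C O) nb nd (x1 + x2))
    as [b Ib]; auto; try lra.
  destruct (sum_of_roots_integer (distance C O) (distance A B) nd nb (x1 + x2))
    as [d Id]; auto; try lra.
  set (c := distance B C) in *.
  set (y := IZR (np - (a - b) * (a - b)) / 16).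
  set (z := IZR (nq - (a - d) * (a - d)) / 16).
  assert (HP : distance O B ^ 2 = (IZR a - IZR b) ^ 2 + 16 * y).
  { rewrite Np. unfold y. rewrite minus_IZR, mult_IZR, minus_IZR. field. }
  assert (HQ : distance A C ^ 2 = (IZR a - IZR d) ^ 2 + 16 * z).
  { rewrite Nq. unfold z. rewrite minus_IZR, mult_IZR, minus_IZR. field. }
  rewrite Ia, Ib, Id in Hs. rewrite Ia in Hp, HA.
  destruct (sigma_tau_values O A B C (IZR a) (IZR b) c (IZR d) y z) as [-> ->]; auto.
  destruct (diagonal_relations O A B C (IZR a) (IZR b) c (IZR d) y z)
    as (E1 & E2 & Qy & Qz & _); auto.
  assert (P1 : 0 <= IZR a) by (rewrite <- Ia; apply distance_pos).
  assert (P2 : 0 <= IZR b) by (rewrite <- Ib; apply distance_pos).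
  assert (P3 : 0 <= c) by apply distance_pos.
  assert (P4 : 0 <= IZR d) by (rewrite <- Id; apply distance_pos).
  (* For [t <= 0] no term is negative, and [s^2] is positive. *)
  assert (pos : forall t k p s : R, 0 <= k -> 0 <= p -> 0 < s ->
    t ^ 2 * (16 + k) - 2 * t * p + s ^ 2 = 0 -> 0 < t).
  { intros t k p s Hk Hpp Hss E. apply Rnot_le_lt. intros L.
    assert (0 <= t ^ 2 * (16 + k)) by (apply Rmult_le_pos; [apply pow2_ge_0|lra]).
    nra. }
  assert (Hy : 0 < y).
  { apply (pos _ _ _ _ (pow2_ge_0 _)) in Qy; auto.
    apply Rplus_le_le_0_compat; apply Rmult_le_pos; auto. }
  assert (Hz : 0 < z).
  { apply (pos _ _ _ _ (pow2_ge_0 _)) in Qz; auto.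
    apply Rplus_le_le_0_compat; apply Rmult_le_pos; auto. }
  assert (Hy1 : 1 < y) by nra.
  set (m := (np - (a - b) * (a - b) - 16)%Z).
  set (k := (nq - (a - d) * (a - d) - 16)%Z).
  assert (Em : IZR m = 16 * y - 16) by (unfold m, y; rewrite minus_IZR; field).
  assert (Ek : IZR k = 16 * z - 16) by (unfold k, z; rewrite minus_IZR; field).
  assert (Hm : (0 < m)%Z) by (apply lt_IZR; lra).
  (* [y z = y + z] means [(y - 1)(z - 1) = 1]. *)
  assert (Hmk : (m * k = 256)%Z).
  { apply eq_IZR. rewrite mult_IZR, Em, Ek. lra. }
  assert (Es : IZR a + c = 2 * IZR a - (IZR a - IZR b) - (IZR a - IZR d)) by lra.
  rewrite Es in E2.
  pose proof (divisors_256 m k Hm Hmk) as Hin.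
  clearbody m k y z. unfold same_pair.
  simpl in Hin. intuition subst m;
    match type of Em with IZR ?i = _ =>
      assert (Hk : k = (256 / i)%Z) by (apply Z.div_unique_exact; lia) end;
    cbv in Hk; subst k.
  (* The nine cases run through [m = 1, 2, 4, ..., 256] with [y = 1 + m / 16]. The two extreme ones
     turn [E2], multiplied by 16, into the excluded equation. *)
  - exfalso. apply (ratio_16_impossible a (a - d) (a - b)).
    apply eq_IZR.
    replace y with (17 / 16) in E2 by lra. replace z with 17 in E2 by lra.
    rewrite !Z.pow_2_r.
    repeat rewrite ?mult_IZR, ?plus_IZR, ?minus_IZR. lra.
  - left; lra.
  - right; left; lra.
  - right; right; left; lra.
  - right; right; right; lra.
  - right; right; left; lra.
  - right; left; lra.
  - left; lra.
  - exfalso. apply (ratio_16_impossible a (a - b) (a - d)).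
    apply eq_IZR.
    replace y with 17 in E2 by lra. replace z with (17 / 16) in E2 by lra.
    rewrite !Z.pow_2_r.
    repeat rewrite ?mult_IZR, ?plus_IZR, ?minus_IZR. lra.
Qed.
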